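(* Let $\mathcal{S}=\{1,\dots,S\}$, let $\mathcal{Y}^s\subseteq\mathbb{R}^p$, $s\in\mathcal{S}$, be finite non-empty sets, and let $\mathcal{Y}=\bigoplus_{s\in\mathcal{S}}\mathcal{Y}^s$. Consider $y\in\mathcal{Y}$ with $y=y^1+\dots+y^S$, where $y^s\in\mathcal{Y}^s$ for $s\in\mathcal{S}$. Then the following hold. 1. If $\lambda\in\mathbb{R}^p_{>}$ and $\mathcal{Y}_\lambda=\{y\}$, then $y\in\mathcal{Y}_{\mathrm{se}}$ and $y^s\in\mathcal{Y}^s_{\mathrm{se}}$ for all $s\in\mathcal{S}$. 2. If $y\in\mathcal{Y}_{\mathrm{se}}$, then $y^s\in\mathcal{Y}^s_{\mathrm{se}}$ for all $s\in\mathcal{S}$. 3. If $y\in\mathcal{Y}_{\mathrm{se}}$, then no other vector sum equals $y$; that is, $(y^1,\dots,y^S)$ is the only tuple in $\mathcal{Y}^1\times\dots\times\mathcal{Y}^S$ whose components sum to $y$. 4. Let $\hat s\in\mathcal{S}$ and let $c\in\mathcal{Y}^{\hat s}_{\mathrm{se}}$. Then there exists an extreme vector $\tilde y\in\mathcal{Y}_{\mathrm{se}}$ such that $\tilde y=\tilde y^1+\dots+\tilde y^S$ with $\tilde y^{\hat s}=c$ and $\tilde y^s\in\mathcal{Y}^s_{\mathrm{se}}$ for all $s\in\mathcal{S}$.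
   Context: For sets $A^s\subseteq\mathbb{R}^p$, $\bigoplus_{s\in\mathcal{S}}A^s=\{\sum_{s\in\mathcal{S}}a^s\mid a^s\in A^s\}$ is the Minkowski sum. $\mathbb{R}^p_{>}$ is the set of vectors with all components strictly positive. For $A\subseteq\mathbb{R}^p$ and $\lambda\in\mathbb{R}^p_{>}$, $A_\lambda=\arg\min\{\lambda^{\mathrm T}a\mid a\in A\}$ is the set of minimizers. The set of (supported) extreme nondominated vectors of $A$ is $A_{\mathrm{se}}=\{a\in A\mid \exists\lambda\in\mathbb{R}^p_{>}: a\in A_\lambda,\ |A_\lambda|=1\}$; for $A=\mathcal{Y}^s$ it is denoted $\mathcal{Y}^s_{\mathrm{se}}$. *)

(* Defs.v *)
From HB Require Import structures.
From mathcomp Require Import all_boot all_order all_algebra.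
From mathcomp Require Import boolp classical_sets functions cardinality reals.

Set Implicit Arguments.
Unset Strict Implicit.
Unset Printing Implicit Defensive.

Import Order.TTheory GRing.Theory Num.Theory.

Local Open Scope classical_set_scope.
Local Open Scope ring_scope.

Definition minkowski_sum (R : realType) (p S : nat)
    (A : 'I_S -> set 'cV[R]_p) : set 'cV[R]_p :=
  [set \sum_(s < S) a s | a in [set a | forall s, A s (a s)]].

Definition positive_vectors (R : realType) (p : nat) : set 'cV[R]_p :=
  [set l | forall i, 0 < l i 0].

Definition weighted_sum (R : realType) (p : nat) (l a : 'cV[R]_p) : R :=
  (l^T *m a) 0 0.

Definition minimizers (R : realType) (p : nat) (A : set 'cV[R]_p)
    (l : 'cV[R]_p) : set 'cV[R]_p :=
  [set a | A a /\ forall b, A b -> weighted_sum l a <= weighted_sum l b].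

Definition extreme_vectors (R : realType) (p : nat) (A : set 'cV[R]_p) :
    set 'cV[R]_p :=
  [set a | A a /\ exists l : 'cV[R]_p,
    [/\ positive_vectors l, minimizers A l a & (minimizers A l #= `I_1)%card]].

(* Main.v *)
Require Import Defs.
From HB Require Import structures.
From mathcomp Require Import all_boot all_order all_algebra.
From mathcomp Require Import boolp classical_sets functions cardinality reals.

(** Linearity of the weighted sum is the whole point: a tuple minimizes
    l^T (a^1 + ... + a^S) over the product of the sets exactly when each
    component minimizes l^T a^s over its own set
    ([minimizers_sumP]), since a single component that could be improved could
    be exchanged alone.  Hence the sum has a unique minimizer for l iff
    every summand has one ([minimizers_summand1], [minimizers_sum1]), and the
    minimizing tuple is then unique as well.  This settles the first three
    claims, all with one and the same weight.

    The last claim needs a new weight: the one that singles out c in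
    Y^s0 may leave ties in the other sets.  The set of positive weights
    that single out c is cut out by finitely many strict linear inequalities,
    so it is open; being nonempty, it contains weights off any finite family
    of hyperplanes ([generic_weight], [separating_weight]).  Avoiding the hyperplanes orthogonal to all
    differences of two distinct points of some Y^s leaves no tie anywhere, so
    every Y^s has a unique minimizer, which is c for s = s0. *)

Set Implicit Arguments.
Unset Strict Implicit.
Unset Printing Implicit Defensive.

Import Order.TTheory GRing.Theory Num.Theory.

Local Open Scope classical_set_scope.
Local Open Scope ring_scope.

(** * Weighted sums *)

Lemma weighted_sumE (R : realType) (p : nat) (l a : 'cV[R]_p) :
  weighted_sum l a = \sum_i l i 0 * a i 0.
Proof. by rewrite /weighted_sum mxE; apply: eq_bigr => i _; rewrite mxE. Qed.

Lemma weighted_sumB (R : realType) (p : nat) (l a b : 'cV[R]_p) :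
  weighted_sum l (a - b) = weighted_sum l a - weighted_sum l b.
Proof. by rewrite /weighted_sum mulmxBr !mxE. Qed.

Lemma weighted_sum_sum (R : realType) (p S : nat) (l : 'cV[R]_p)
    (a : 'I_S -> 'cV[R]_p) :
  weighted_sum l (\sum_(s < S) a s) = \sum_(s < S) weighted_sum l (a s).
Proof. by rewrite /weighted_sum mulmx_sumr summxE. Qed.

Lemma weighted_sum_perturb (R : realType) (p : nat) (l d a : 'cV[R]_p) (t : R) :
  weighted_sum (l + t *: d) a = weighted_sum l a + t * weighted_sum d a.
Proof. by rewrite /weighted_sum linearD linearZ mulmxDl -scalemxAl !mxE. Qed.

Lemma weighted_sum_delta (R : realType) (p : nat) (l : 'cV[R]_p) (i : 'I_p) :
  weighted_sum l (delta_mx i 0) = l i 0.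
Proof. by rewrite /weighted_sum -colE !mxE. Qed.

Lemma weighted_sum_self_neq0 (R : realType) (p : nat) (d : 'cV[R]_p) :
  d != 0 -> weighted_sum d d != 0.
Proof.
apply: contraNneq; rewrite weighted_sumE => /eqP.
rewrite psumr_eq0 => [/allP d0|i _]; last by rewrite -expr2 sqr_ge0.
apply/eqP/matrixP => i j; rewrite (ord1 j) mxE.
by have := d0 i (mem_index_enum i); rewrite mulf_eq0 orbb => /eqP.
Qed.

(** * Extreme vectors and unique minimizers *)

Lemma card_I1_set1 (T : Type) (A : set T) (a : T) :
  (A #= `I_1)%card -> A a -> A = [set a].
Proof.
move=> /card_set_bijP [f [fI1 finj _]] Aa.
apply/seteqP; split=> [b Ab|b ->//].
apply: finj; rewrite ?inE//.
have := fI1 _ Ab; have := fI1 _ Aa => /=.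
by case: (f a) (f b) => [|?] [|?].
Qed.

Lemma extreme_vectorsP (R : realType) (p : nat) (A : set 'cV[R]_p)
    (a : 'cV[R]_p) :
  extreme_vectors A a <->
  exists2 l, positive_vectors l & minimizers A l = [set a].
Proof.
split=> [[_ [l [l0 la lI1]]]|[l l0 la]].
  by exists l => //; exact: card_I1_set1.
have ma : minimizers A l a by rewrite la.
by split; [case: ma | exists l; split; rewrite // la card_set1].
Qed.

Lemma minimizers_nonempty (R : realType) (p : nat) (A : set 'cV[R]_p)
    (l : 'cV[R]_p) :
  finite_set A -> A !=set0 -> minimizers A l !=set0.
Proof.
move=> /finite_seqP [s ->] [a /= sa].
case: (@arg_minP _ _ _ (SeqSub sa) predT (fun i => weighted_sum l (val i))) => //.
move=> i _ imin; exists (val i); split=> [|b /= sb]; first exact: valP.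
exact: (imin (SeqSub sb)).
Qed.

(** * Minimizers of a Minkowski sum *)

(** Replacing the component [s] of a minimizing tuple by any [b] in [A s] and
    cancelling the untouched components gives the left-to-right direction. *)
Lemma minimizers_sumP (R : realType) (p S : nat) (A : 'I_S -> set 'cV[R]_p)
    (l : 'cV[R]_p) (a : 'I_S -> 'cV[R]_p) :
  (forall s, A s (a s)) ->
  minimizers (minkowski_sum A) l (\sum_(s < S) a s) <->
  (forall s, minimizers (A s) l (a s)).
Proof.
move=> Aa; split=> [[_ amin] s|amin].
  split=> // b Ab; pose a' := @dfwith _ (fun=> 'cV[R]_p) a s b.
  have Aa' t : A t (a' t) by rewrite /a'; case: dfwithP.
  have /amin : minkowski_sum A (\sum_(t < S) a' t) by exists a'.
  rewrite !weighted_sum_sum (bigD1 s)//= [X in _ <= X](bigD1 s)//= /a' dfwith_in.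
  rewrite [X in _ <= _ + X](eq_bigr (fun t => weighted_sum l (a t))) ?lerD2r//.
  by move=> t ts; rewrite dfwith_out// eq_sym.
split; first by exists a.
move=> _ [b Ab <-]; rewrite !weighted_sum_sum; apply: ler_sum => s _.
exact: (amin s).2.
Qed.

Lemma minimizers_summand1 (R : realType) (p S : nat)
    (A : 'I_S -> set 'cV[R]_p) (l : 'cV[R]_p) (a : 'I_S -> 'cV[R]_p) :
  (forall s, A s (a s)) ->
  minimizers (minkowski_sum A) l = [set \sum_(s < S) a s] ->
  forall s, minimizers (A s) l = [set a s].
Proof.
move=> Aa amin s.
have /(minimizers_sumP l Aa) mina :
  minimizers (minkowski_sum A) l (\sum_(s < S) a s) by rewrite amin.
apply/seteqP; split=> [b mb|_ -> //].
(* Exchanging a s for another minimizer b keeps the tuple minimizing, so by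
   uniqueness it keeps the sum, and the other components cancel. *)
pose a' := @dfwith _ (fun=> 'cV[R]_p) a s b.
have mina' t : minimizers (A t) l (a' t) by rewrite /a'; case: dfwithP.
have : minimizers (minkowski_sum A) l (\sum_(t < S) a' t).
  by apply/minimizers_sumP => // t; case: (mina' t).
rewrite amin /= (bigD1 s)//= [RHS](bigD1 s)//= /a' dfwith_in.
rewrite (eq_bigr a) => [/addIr //|t ts].
by rewrite dfwith_out// eq_sym.
Qed.

Lemma minimizers_sum1 (R : realType) (p S : nat)
    (A : 'I_S -> set 'cV[R]_p) (l : 'cV[R]_p) (a : 'I_S -> 'cV[R]_p) :
  (forall s, minimizers (A s) l = [set a s]) ->
  minimizers (minkowski_sum A) l = [set \sum_(s < S) a s].
Proof.
move=> amin.
have mina s : minimizers (A s) l (a s) by rewrite amin.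
apply/seteqP; split=> [_ /[dup] [[[b Ab <-] _]]|_ ->].
  move=> /(minimizers_sumP l Ab) minb; congr (\sum_(s < S) _).
  by apply/funext => s; have := minb s; rewrite amin.
by apply/minimizers_sumP => // s; case: (mina s).
Qed.

(** * Weights in general position *)

(** The bound is required for all small [t] so that bounds for several
    vectors can be combined by taking their minimum. *)
Lemma perturb_positive (R : realType) (p : nat) (P : seq 'cV[R]_p)
    (l d : 'cV[R]_p) :
  (forall u, u \in P -> 0 < weighted_sum l u) ->
  exists2 e : R, 0 < e & forall t, 0 < t -> t <= e ->
    forall u, u \in P -> 0 < weighted_sum (l + t *: d) u.
Proof.
elim: P => [_|u P IH Ppos]; first by exists 1.
have [v vP|e e0 eP] := IH; first by rewrite Ppos// inE vP orbT.
have lu0 : 0 < weighted_sum l u by rewrite Ppos// mem_head.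
set c := 1 + `|weighted_sum d u|.
have c0 : 0 < c by rewrite ltr_pwDl.
exists (Num.min e (weighted_sum l u / c)) => [|t t0].
  by rewrite lt_min e0 divr_gt0.
rewrite le_min => /andP[te]; rewrite ler_pdivlMr// => tc v.
rewrite inE => /orP[/eqP ->|/(eP t t0 te)//].
rewrite weighted_sum_perturb -ltrBlDr sub0r.
apply: lt_le_trans tc.
rewrite -mulrN ltr_pM2l// (le_lt_trans (ler_norm _))// normrN /c.
by rewrite ltrDr.
Qed.

(** Moving the weight in the direction [v] itself leaves the hyperplane
    orthogonal to [v].  To stay off it while the remaining vectors of [D] are
    treated, [v] or [- v], whichever has become positive, joins the positivity
    constraints: these survive small perturbations. *)
Lemma generic_weight (R : realType) (p : nat) (D P : seq 'cV[R]_p)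
    (l : 'cV[R]_p) :
  (forall v, v \in D -> v != 0) ->
  (forall u, u \in P -> 0 < weighted_sum l u) ->
  exists l' : 'cV[R]_p, (forall u, u \in P -> 0 < weighted_sum l' u) /\
    (forall v, v \in D -> weighted_sum l' v != 0).
Proof.
elim: D P l => [|v D IH] P l D0 Ppos; first by exists l.
have v0 : v != 0 by rewrite D0// mem_head.
have D0' w : w \in D -> w != 0 by move=> wD; rewrite D0// inE wD orbT.
have [l1 P1 l1v] : exists2 l1 : 'cV[R]_p,
    forall u, u \in P -> 0 < weighted_sum l1 u & weighted_sum l1 v != 0.
  have [lv|lv] := eqVneq (weighted_sum l v) 0; last by exists l.
  have [e e0 eP] := perturb_positive v Ppos.
  exists (l + e *: v); first exact: eP.
  rewrite weighted_sum_perturb lv add0r mulf_neq0 ?weighted_sum_self_neq0//.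
  by rewrite gt_eqF.
have wN w u : weighted_sum w (- u) = - weighted_sum w u :> R.
  by rewrite /weighted_sum mulmxN mxE.
pose v' := if 0 < weighted_sum l1 v then v else - v.
have [u|l2 [P2 D2]] := IH (v' :: P) l1 D0'.
  rewrite inE => /orP[/eqP ->|/P1//]; rewrite /v'.
  by case: ifPn => // l1v_le0; rewrite wN oppr_gt0 lt_neqAle l1v leNgt.
exists l2; split=> [u uP|w]; first by rewrite P2// inE uP orbT.
rewrite inE => /orP[/eqP ->|/D2//].
have := P2 v' (mem_head _ _); rewrite /v'.
by case: ifP => _; rewrite ?wN ?oppr_gt0 => l2v; rewrite neq_lt l2v ?orbT.
Qed.

(** The positivity constraints encode that the weight is positive (tested on
    the unit vectors) and that it still prefers [c] to the rest of [A s0]. *)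
Lemma separating_weight (R : realType) (p S : nat)
    (A : 'I_S -> set 'cV[R]_p) (s0 : 'I_S) (c l : 'cV[R]_p) :
  (forall s, finite_set (A s)) ->
  positive_vectors l -> minimizers (A s0) l = [set c] ->
  exists l' : 'cV[R]_p,
    [/\ positive_vectors l', minimizers (A s0) l' = [set c] &
      forall s a b, A s a -> A s b -> weighted_sum l' a = weighted_sum l' b ->
        a = b].
Proof.
move=> Afin l0 lc.
have /choice [sA sAE] : forall s, exists r : seq 'cV[R]_p, A s = [set` r].
  by move=> s; apply/finite_seqP.
have inA s a : A s a <-> a \in sA s by rewrite sAE.
have [Ac cmin] : minimizers (A s0) l c by rewrite lc.
pose P := [seq (delta_mx i 0 : 'cV[R]_p) | i <- enum 'I_p] ++
          [seq b - c | b <- sA s0 & b != c].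
pose D := [seq u <- flatten [seq [seq a - b | a <- sA s, b <- sA s] |
                             s <- enum 'I_S] | u != 0].
have D0 v : v \in D -> v != 0 by rewrite mem_filter => /andP[].
have Ppos u : u \in P -> 0 < weighted_sum l u.
  rewrite mem_cat => /orP[/mapP[i _ ->]|/mapP[b + ->]].
    by rewrite weighted_sum_delta.
  rewrite mem_filter => /andP[bc /inA Ab].
  rewrite weighted_sumB subr_gt0 lt_neqAle cmin// andbT.
  apply: contraNneq bc => lcb; apply/eqP.
  suff : minimizers (A s0) l b by rewrite lc.
  by split=> // a /cmin; rewrite lcb.
have [l' [P' D']] := generic_weight D0 Ppos; exists l'.
have Ac' b : A s0 b -> b != c -> weighted_sum l' c < weighted_sum l' b.
  move=> /inA Ab bc; rewrite -subr_gt0 -weighted_sumB P'// mem_cat.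
  by apply/orP; right; apply/mapP; exists b; rewrite // mem_filter bc.
split.
- move=> i; rewrite -weighted_sum_delta P'// mem_cat.
  by apply/orP; left; apply/mapP; exists i; rewrite ?mem_enum.
- apply/seteqP; split=> [b [Ab bmin]|_ ->].
    by apply/eqP/negPn/negP => /(Ac' b Ab); rewrite ltNge bmin.
  split=> // b Ab; have [->//|bc] := eqVneq b c.
  exact/ltW/Ac'.
- move=> s a b /inA Aa /inA Ab lab; apply/eqP; rewrite -subr_eq0.
  apply/negPn/negP => ab; suff /D' : a - b \in D.
    by rewrite weighted_sumB lab subrr eqxx.
  rewrite mem_filter ab; apply/flattenP.
  exists [seq a - b | a <- sA s, b <- sA s].
    by apply/mapP; exists s; rewrite ?mem_enum.
  by apply/allpairsP; exists (a, b).
Qed.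

Theorem proposition3p2 (R : realType) (p S : nat)
    (Y : 'I_S -> set 'cV[R]_p)
    (Y_finite : forall s, finite_set (Y s))
    (Y_nonempty : forall s, Y s !=set0)
    (y : 'cV[R]_p) (ys : 'I_S -> 'cV[R]_p)
    (y_in : minkowski_sum Y y)
    (ys_in : forall s, Y s (ys s))
    (y_sum : y = \sum_(s < S) ys s) :
  [/\ forall l : 'cV[R]_p, positive_vectors l ->
        minimizers (minkowski_sum Y) l = [set y] ->
        extreme_vectors (minkowski_sum Y) y /\
        (forall s, extreme_vectors (Y s) (ys s)),
      extreme_vectors (minkowski_sum Y) y ->
        forall s, extreme_vectors (Y s) (ys s),
      extreme_vectors (minkowski_sum Y) y ->
        forall zs : 'I_S -> 'cV[R]_p, (forall s, Y s (zs s)) ->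
          \sum_(s < S) zs s = y -> zs = ys
    & forall (s0 : 'I_S) (c : 'cV[R]_p), extreme_vectors (Y s0) c ->
        exists (y' : 'cV[R]_p) (ys' : 'I_S -> 'cV[R]_p),
          [/\ extreme_vectors (minkowski_sum Y) y',
              y' = \sum_(s < S) ys' s,
              ys' s0 = c
            & forall s, extreme_vectors (Y s) (ys' s)]].
Proof.
have extreme_summands l : positive_vectors l ->
    minimizers (minkowski_sum Y) l = [set y] ->
    forall s, extreme_vectors (Y s) (ys s).
  move=> l0; rewrite y_sum => ly s; apply/extreme_vectorsP.
  by exists l; rewrite // (minimizers_summand1 ys_in ly).
split.
- move=> l l0 ly; split; last exact: extreme_summands ly.
  by apply/extreme_vectorsP; exists l.
- by move=> /extreme_vectorsP[l l0 ly]; exact: extreme_summands ly.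
- move=> /extreme_vectorsP[l l0 ly] zs Yzs zsy.
  have ys1 s : minimizers (Y s) l = [set ys s].
    by apply: minimizers_summand1; rewrite // -y_sum.
  have zs1 s : minimizers (Y s) l = [set zs s].
    by apply: minimizers_summand1; rewrite // zsy.
  apply/funext => s; have : [set ys s] (zs s) by rewrite -ys1 zs1.
  by [].
- move=> s0 c /extreme_vectorsP[l l0 lc].
  have [l' [l'0 l'c l'inj]] := separating_weight Y_finite l0 lc.
  have /choice [ys' ys'min] : forall s, exists a, minimizers (Y s) l' a.
    by move=> s; exact: minimizers_nonempty.
  have ys'1 s : minimizers (Y s) l' = [set ys' s].
    have [Ya amin] := ys'min s.
    apply/seteqP; split=> [b [Yb bmin]|_ -> //].
    by apply: (l'inj s) => //; apply/le_anti; rewrite amin// bmin.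
  exists (\sum_(s < S) ys' s), ys'; split=> //.
  + by apply/extreme_vectorsP; exists l' => //; exact: minimizers_sum1.
  + by have := ys'min s0; rewrite l'c.
  + by move=> s; apply/extreme_vectorsP; exists l'.
Qed.
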